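(* Every infinite, connected, locally finite, vertex transitive graph $G$ has a perfect matching.
   Context: A perfect matching of $G$ is a set $M$ of edges such that every vertex of $G$ is incident to exactly one edge of $M$. Vertex transitive means the automorphism group of $G$ acts transitively on vertices. *)

(* Defs.v *)
From Stdlib Require Import Relations.
From mathcomp Require Import all_boot.
From mathcomp Require Import all_classical.

Set Implicit Arguments.
Unset Strict Implicit.
Unset Printing Implicit Defensive.

Local Open Scope classical_set_scope.

(* Simple graphs, possibly infinite. *)
Record graph := Graph {
  vertex : Type;
  adj : vertex -> vertex -> Prop;
  adj_sym : forall x y, adj x y -> adj y x;
  adj_irrefl : forall x, ~ adj x x
}.

(* An edge is the unordered pair of its endpoints, as a set of vertices. *)
Definition edges (G : graph) : set (set (vertex G)) :=
  [set e | exists x y, adj x y /\ e = [set x; y]].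
Arguments edges : clear implicits.

Definition infinite_graph (G : graph) : Prop := infinite_set [set: vertex G].

Definition connected_graph (G : graph) : Prop :=
  [set: vertex G] !=set0 /\
  forall x y : vertex G, clos_refl_trans (vertex G) (@adj G) x y.

Definition locally_finite (G : graph) : Prop :=
  forall x : vertex G, finite_set [set y | adj x y].

Definition automorphism (G : graph) (f : vertex G -> vertex G) : Prop :=
  bijective f /\ forall x y, adj (f x) (f y) <-> adj x y.

Definition vertex_transitive (G : graph) : Prop :=
  forall x y : vertex G, exists f, automorphism f /\ f x = y.

Definition perfect_matching (G : graph) (M : set (set (vertex G))) : Prop :=
  M `<=` edges G /\ forall v : vertex G, exists! e, M e /\ e v.

(* Main.v *)
(* Call a finite set of vertices matchable if some matching covers it. Flipping
   alternating components shows that the matchable sets are the independent sets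
   of a matroid. If the graph has no perfect matching, compactness gives a finite
   circuit, and by transitivity every vertex lies in one. Suppose [x] and [y] are
   adjacent and a circuit [C] contains [x] but not [y]. With [D] a circuit at
   [y], a maximal matchable subset of [C `|` D] minus [y] that contains [C `\ x]
   spans both [x] and [y], so its matching covers neither and can be enlarged by
   the edge [x y], a contradiction. Hence a circuit is closed under adjacency; by
   connectedness it is the whole vertex set, which is infinite. *)

From mathcomp Require Import all_boot finmap zify.
From mathcomp Require Import all_classical.
Require Import Defs.

Set Implicit Arguments.
Unset Strict Implicit.
Unset Printing Implicit Defensive.

Local Open Scope classical_set_scope.
Local Open Scope fset_scope.

(* A matching is encoded as the involution that swaps the ends of its edges and
   fixes the uncovered vertices. *)
Definition matching_fun (T : choiceType) (e : T -> T -> Prop) (m : T -> T) :=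
  involutive m /\ forall x, m x != x -> e x (m x).

Definition matchable (T : choiceType) (e : T -> T -> Prop) (A : {fset T}) :=
  exists2 m, matching_fun e m & forall x, x \in A -> m x != x.

Lemma matchable0 (T : choiceType) (e : T -> T -> Prop) : matchable e fset0.
Proof. by exists id => //; split=> // x; rewrite eqxx. Qed.

Lemma matchableS (T : choiceType) (e : T -> T -> Prop) (A B : {fset T}) :
  A `<=` B -> matchable e B -> matchable e A.
Proof. by move=> /fsubsetP AB [m mm mB]; exists m => // x /AB /mB. Qed.

(** Conjugation by [m] turns [m \o m'] into its inverse [m' \o m]. *)
Lemma iter_conj_involution (T : Type) (m m' : T -> T) n x :
  involutive m -> involutive m' ->
  iter n (m \o m') (m (iter n (m \o m') x)) = m x.
Proof.
move=> mK mK'; elim: n => // n IHn.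
by rewrite iterSr iterS /= mK mK'.
Qed.

(* If [k ^ n a] is fixed by [m'] and [a] by [m], the path bounces back at both
   ends, so [k ^ (2 n + 1)] fixes [a]; two starting points [a] and [k ^ d a] give
   [k ^ (2 d)] fixing [a] as well, and then [k ^ d] does by parity. *)
Lemma alternating_end_inj (T : Type) (m m' : T -> T) n1 n2 a1 a2 :
  involutive m -> involutive m' -> m a1 = a1 -> m a2 = a2 ->
  let k := m \o m' in
  m' (iter n1 k a1) = iter n1 k a1 -> iter n1 k a1 = iter n2 k a2 -> a1 = a2.
Proof.
move=> mK mK' ma1 ma2 k.
have kI : injective k by apply: inj_comp; apply: can_inj.
have kIn n : injective (iter n k).
  by elim: n => [|n IHn] //= x y /kI /IHn.
have period a n : m a = a -> m' (iter n k a) = iter n k a ->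
    iter n.*2.+1 k a = a.
  move=> ma m'b; have -> : n.*2.+1 = (n + n.+1)%N by lia.
  by rewrite iterD iterS {2}/k /= m'b iter_conj_involution.
wlog le_n : n1 n2 a1 a2 ma1 ma2 / n1 <= n2 => [H m'b eq_b|].
  case/orP: (leq_total n1 n2) => le_n; first exact: (H n1 n2).
  by apply/esym; apply: (H n2 n1) => //; rewrite -eq_b.
move=> m'b eq_b.
have a1E : a1 = iter (n2 - n1) k a2.
  by apply: (kIn n1); rewrite -iterD subnKC.
have p1 := period _ _ ma1 m'b.
rewrite eq_b in m'b; have p2 := period _ _ ma2 m'b.
set d := (n2 - n1)%N in a1E.
have p3 : iter n1.*2.+1 k a2 = a2.
  by apply: (kIn d); rewrite -iterD addnC iterD -a1E.
have p4 : iter d.*2 k a2 = a2.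
  apply: (kIn n1.*2.+1); rewrite p3 -iterD.
  by have -> : (n1.*2.+1 + d.*2 = n2.*2.+1)%N by lia.
have mul n q : iter n k a2 = a2 -> iter (q * n) k a2 = a2.
  by move=> pn; elim: q => // q IHq; rewrite mulSn iterD IHq.
rewrite a1E -{1}(mul _ n1 p4) -iterD.
have -> : (d + n1 * d.*2 = d * n1.*2.+1)%N by nia.
exact: mul.
Qed.

(** This is matroid exchange. If nothing could be added to [A], each alternating path from a point
    of [A'] outside [A] would end at a point of [A] outside [A'], with different ends for different
    starts, so [A'] would not be larger. *)
Lemma matchable_augment (T : choiceType) (e : T -> T -> Prop) (A A' : {fset T}) :
  matchable e A -> matchable e A' -> #|` A| < #|` A'| ->
  exists a, [/\ a \in A', a \notin A & matchable e (a |` A)].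
Proof.
move=> [m [mK me] mA] [m' [mK' me'] mA'] ltA; apply: contrapT => noaug.
pose k := m \o m'.
have ma a : a \in A' `\` A -> m a = a.
  rewrite inE => /andP[aNA aA']; apply/eqP; apply: contrapT => /negP maN.
  apply: noaug; exists a; split=> //; exists m => // x.
  by rewrite !inE => /orP[/eqP->|/mA].
have exb a : a \in A' `\` A ->
    exists b, [/\ b \in A `\` A', m' b = b & exists n, b = iter n k a].
  move=> aD; have maa := ma _ aD; move: aD; rewrite inE => /andP[aNA aA'].
  (* [K] is the alternating component of [a]. It is closed under [m] because [m] fixes [a], so using
     [m'] on it and [m] elsewhere gives a matching [f]. *)
  pose K x := `[< exists n, x = iter n k a \/ x = m' (iter n k a) >].
  have Km' x : K x -> K (m' x).
    by move=> /asboolP[n [->|->]]; apply/asboolP; exists n; rewrite ?mK'; auto.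
  have Km x : K x -> K (m x).
    move=> /asboolP[[|n] [->|->]]; apply/asboolP.
    - by exists 0; left.
    - by exists 1; left.
    - by exists n; right; rewrite /= mK.
    - by exists n.+2; left.
  have K'E x : K (m' x) = K x.
    by apply/idP/idP => [/Km'|/Km' //]; rewrite mK'.
  have KE x : K (m x) = K x.
    by apply/idP/idP => [/Km|/Km //]; rewrite mK.
  pose f x := if K x then m' x else m x.
  have fm : matching_fun e f.
    split=> x; rewrite {2}/f; case: ifPn => Kx.
    - by rewrite /f K'E Kx mK'.
    - by rewrite /f KE (negPf Kx) mK.
    - by rewrite /f Kx; apply: me'.
    - by rewrite /f (negPf Kx); apply: me.
  have fa : f a != a.
    rewrite /f; have -> : K a by apply/asboolP; exists 0; left.
    exact: mA'.
  (* Since [f] covers [a], by [noaug] it misses some [b] in [A]; as [m] covers [A], this [b] lies in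
     [K] and is fixed by [m']. *)
  have [b bA fb] : exists2 b, b \in A & f b = b.
    apply: contrapT => nob; apply: noaug; exists a; split=> //.
    exists f => // x; rewrite !inE => /orP[/eqP-> //|xA].
    by apply/eqP => fx; apply: nob; exists x.
  move: fb; rewrite /f; case: ifPn => Kb fb; last first.
    by move: (mA _ bA); rewrite fb eqxx.
  exists b; split=> //.
    by rewrite inE bA andbT; apply/negP => /mA'; rewrite fb eqxx.
  move: Kb => /asboolP[n [->|bE]]; first by exists n.
  by exists n; rewrite -fb bE mK'.
have /choice[g gP] a : exists b, a \in A' `\` A ->
    [/\ b \in A `\` A', m' b = b & exists n, b = iter n k a].
  by have [/exb[b bP]|aN] := boolP (a \in A' `\` A); [exists b | exists a].
have le_D : #|` A' `\` A| <= #|` A `\` A'|.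
  have <- : #|` [fset g a | a in A' `\` A]| = #|` A' `\` A|.
    apply: card_in_imfset => a1 a2 /= a1D a2D eq_g.
    have [_ m'g1 [n1 g1]] := gP _ a1D; have [_ _ [n2 g2]] := gP _ a2D.
    apply: (@alternating_end_inj _ m m' n1 n2) => //; rewrite ?ma //.
      by rewrite -g1.
    by rewrite -g1 -g2.
  by apply/fsubset_leq_card/fsubsetP => _ /imfsetP[a aD ->]; have [] := gP _ aD.
have := cardfsID A A'; have := cardfsID A' A; rewrite fsetIC; lia.
Qed.

Lemma exists_max_matchable (T : choiceType) (e : T -> T -> Prop) (A E : {fset T}) :
  A `<=` E -> matchable e A ->
  exists B, [/\ A `<=` B, B `<=` E, matchable e B &
    forall x, x \in E -> matchable e (x |` B) -> x \in B].
Proof.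
have [n le_n] := ubnP #|` E `\` A|; elim: n => // n IHn in A le_n *.
move=> AE mA.
have [maxA|] := pselect (forall x, x \in E -> matchable e (x |` A) -> x \in A).
  by exists A.
move=> /existsNP[x /not_implyP[xE /not_implyP[mxA /negP xNA]]].
have [|||B [xAB BE mB maxB]] := IHn (x |` A) => //.
- move: le_n; rewrite (cardfsD1 x (E `\` A)) !inE xE xNA /= add1n.
  by rewrite fsetDDl fsetUC.
- by rewrite fsubUset AE fsub1set xE.
- exists B; split=> //; apply: fsubset_trans xAB; exact: fsubsetUr.
Qed.

Lemma exists_matching_circuit (T : choiceType) (e : T -> T -> Prop) (A : {fset T}) :
  ~ matchable e A ->
  exists2 C, ~ matchable e C & forall x, x \in C -> matchable e (C `\ x).
Proof.
have [n le_n] := ubnP #|` A|; elim: n => // n IHn in A le_n *.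
move=> mA; have [minA|] := pselect (forall x, x \in A -> matchable e (A `\ x)).
  by exists A.
move=> /existsNP[x /not_implyP[xA mAx]]; apply: IHn mAx.
by rewrite (cardfsD1 x A) xA in le_n.
Qed.

(** A matching covering [I] either already covers [x] or [y], or leaves both free and can be
    enlarged by the edge between them. *)
Lemma matchable_edge (T : choiceType) (e : T -> T -> Prop) (I : {fset T}) x y :
  (forall u v, e u v -> e v u) -> (forall u, ~ e u u) -> e x y ->
  matchable e I -> matchable e (x |` I) \/ matchable e (y |` I).
Proof.
move=> esym eirr exy [m [mK me] mI].
have xNy : x != y by apply/eqP => xy; apply: (eirr x); rewrite {2}xy.
have cover z : m z != z -> matchable e (z |` I).
  by move=> mz; exists m => // u; rewrite !inE => /orP[/eqP->|/mI].
have [/eqP mx|/cover] := boolP (m x == x); last by left.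
have [/eqP my|/cover] := boolP (m y == y); last by right.
left; pose f z := if z == x then y else if z == y then x else m z.
have fx : f x = y by rewrite /f eqxx.
have fy : f y = x by rewrite /f eq_sym (negPf xNy) eqxx.
have fm z : z != x -> z != y -> f z = m z by rewrite /f => /negPf-> /negPf->.
have mN z u : m u = u -> z != u -> m z != u.
  by move=> mu; apply: contraNN => /eqP mz; rewrite -(mK z) mz mu.
exists f => [|z].
  split=> z; have [->|zx] := eqVneq z x; rewrite ?fx ?fy //;
    have [->|zy] := eqVneq z y; rewrite ?fx ?fy //.
  - by rewrite !fm ?mN.
  - by move=> _; apply: esym.
  - by rewrite fm //; apply: me.
rewrite !inE; have [->|zx] := eqVneq z x; first by rewrite fx eq_sym.
have [->|zy] := eqVneq z y; first by rewrite fy.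
by rewrite fm //=; apply: mI.
Qed.

Lemma circuit_adj (T : choiceType) (e : T -> T -> Prop) (C D : {fset T}) x y :
  (forall u v, e u v -> e v u) -> (forall u, ~ e u u) -> e x y ->
  x \in C -> ~ matchable e C -> matchable e (C `\ x) ->
  matchable e D -> ~ matchable e (y |` D) -> y \in C.
Proof.
move=> esym eirr exy xC nC mCx mD nD; apply: contrapT => /negP yNC.
have yND : y \notin D by apply/negP => yD; apply: nD; rewrite mem_fset1U.
pose E := (C `|` D) `\ y.
have CxE : C `\ x `<=` E.
  apply/fsubsetP => z; rewrite !inE => /andP[_ zC]; rewrite zC /= andbT.
  by apply: contraNneq yNC => <-.
have DE : D `<=` E.
  apply/fsubsetP => z zD; rewrite !inE zD orbT andbT.
  by apply: contraNneq yND => <-.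
(* [I] and [J] are bases of the same set [E]; [I] spans [x] through the circuit [C], and [J] spans
   [y] through [D]. *)
have [I [CI /fsubsetP IE mI maxI]] := exists_max_matchable CxE mCx.
have [J [DJ /fsubsetP JE mJ maxJ]] := exists_max_matchable DE mD.
have nxI : ~ matchable e (x |` I).
  apply: contra_not nC; apply: matchableS; rewrite -(fsetD1K xC).
  exact: fsetUS.
have nyJ : ~ matchable e (y |` J).
  by apply: contra_not nD; apply: matchableS; apply: fsetUS.
have [//|myI] := matchable_edge esym eirr exy mI.
have yNI : y \notin I by apply/negP => /IE; rewrite !inE eqxx.
(* By maximality of [I], [J] is not larger, so exchange adds to [J] a point of [I] or [y] itself.
   Maximality of [J] excludes the former, [nyJ] the latter. *)
have [ltIJ|leJI] := ltnP #|` I| #|` J|.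
  have [a [aJ /negP aNI maI]] := matchable_augment mI mJ ltIJ.
  by apply: aNI; apply: maxI => //; apply: JE.
have [|a [ayI /negP aNJ maJ]] := matchable_augment mJ myI.
  by rewrite cardfsU1 yNI.
move: ayI; rewrite !inE => /orP[/eqP ay|aI]; first by rewrite ay in maJ.
by apply: aNJ; apply: maxJ => //; apply: IE.
Qed.

(** The perfect matching is a limit, along an ultrafilter on finite sets, of matchings [M B]
    covering [B]. *)
Lemma matching_compactness (T : choiceType) (e : T -> T -> Prop) :
  (forall x, finite_set [set y | e x y]) -> (forall A, matchable e A) ->
  exists2 m, matching_fun e m & forall x, m x != x.
Proof.
move=> efin mA.
have /choice[M MP] (A : {fset T}) : exists m,
    matching_fun e m /\ forall x, x \in A -> m x != x.
  by have [m mm mx] := mA A; exists m.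
pose F := filter_from [set: {fset T}] (fun A => [set B | A `<=` B]).
have FF : ProperFilter F.
  apply: filter_from_proper; last by move=> A _; exists A => /=.
  apply: filter_from_filter; first by exists fset0.
  move=> A B _ _; exists (A `|` B) => // D /=.
  by rewrite fsubUset => /andP[].
have [U [UU FU]] := ultraFilterLemma FF.
have /choice[m mP] x : exists y, U [set B | M B x = y /\ M B x != x].
  have Ux : U [set B | x \in B].
    by apply: FU; exists [fset x] => // B /=; rewrite fsub1set.
  apply: contrapT => /forallNP noy.
  (* If every neighbour of [x] were excluded on a set in [U], finiteness would exclude all of them
     at once, yet [M B x] is a neighbour whenever [B] contains [x]. *)
  have Un : U (\bigcap_(y in [set` fset_set [set y | e x y]])
      ~` [set B | M B x = y /\ M B x != x]).
    apply: filter_bigI => y _.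
    by have [/noy|] := in_ultra_setVsetC [set B | M B x = y /\ M B x != x] UU.
  have [B [/= xB]] := filter_ex (filterI Ux Un).
  have [[_ Me] /(_ _ xB) MBx] := MP B.
  by move=> /(_ (M B x)); apply=> //=; rewrite in_fset_set // inE; apply: Me.
exists m; last first.
  by move=> x; have [B [/= <-]] := filter_ex (mP x).
split=> x; last first.
  by have [B [/= <- _]] := filter_ex (mP x); have [[_ Me] _] := MP B; apply: Me.
(* A single [B] gives the values of [m] at both [x] and [m x], so [m] inherits the involution law
   from [M B]. *)
have [B [[/= MBx _] [<- _]]] := filter_ex (filterI (mP x) (mP (m x))).
by rewrite -MBx; have [[->]] := MP B.
Qed.

Lemma matchable_image (T : choiceType) (e : T -> T -> Prop) (f : T -> T)
    (A : {fset T}) :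
  bijective f -> (forall x y, e (f x) (f y) <-> e x y) ->
  matchable e (f @` A) <-> matchable e A.
Proof.
move=> [g fK gK] fe; split=> -[m [mK me] mA].
  exists (g \o m \o f).
    split=> x /=; first by rewrite gK mK fK.
    move=> gx; apply/fe; rewrite gK; apply: me.
    by apply: contraNneq gx => ->; rewrite fK.
  move=> x xA /=; apply: contraNneq (mA (f x) (in_imfset _ _ xA)) => gx.
  by rewrite -{2}gx gK.
exists (f \o m \o g).
  split=> x /=; first by rewrite fK mK gK.
  move=> fx; rewrite -{1}(gK x); apply/fe; apply: me.
  by apply: contraNneq fx => ->; rewrite gK.
move=> _ /imfsetP[x xA ->] /=; rewrite fK (inj_eq (can_inj fK)).
exact: mA.
Qed.

Theorem theorem2 (G : graph) :
  infinite_graph G -> connected_graph G -> locally_finite G ->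
  vertex_transitive G ->
  exists M : set (set (vertex G)), perfect_matching M.
Proof.
move=> Ginf [_ Gconn] Gfin Gtrans.
pose T : choiceType := {classic vertex G}.
pose e : T -> T -> Prop := @adj G.
have [|nall] := pselect (forall A : {fset T}, matchable e A).
  move=> /(@matching_compactness T e Gfin)[m [mK me] mx].
  exists [set p : set (vertex G) | exists v : T, p = [set v; m v]%classic]; split.
    by move=> p [v ->]; exists v, (m v); split=> //; apply: me.
  move=> v; exists [set v; m v]%classic; split.
    by split; [exists v | left].
  move=> _ [[w ->] [->|->]] //=.
  by rewrite mK setUC.
exfalso; move/existsNP: nall => [A /exists_matching_circuit[C nC minC]].
have [x0 x0C] : exists x0, x0 \in C.
  have [C0|[x0 x0C]] := fset_0Vmem C; last by exists x0.
  by case: nC; rewrite C0; apply: matchable0.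
(* An automorphism taking [x0] to [y] carries [C] to a circuit through [y]; removing [y] from it
   gives [D]. *)
have spanned (y : T) : exists2 D, matchable e D & ~ matchable e (y |` D).
  have [g [[gbij ge] <-]] := Gtrans x0 y.
  have imE A' : matchable e ((g : T -> T) @` A') <-> matchable e A'.
    exact: (@matchable_image T e g A' gbij ge).
  exists ((g : T -> T) @` (C `\ x0)); first by apply/imE; apply: minC.
  by rewrite -(@imfsetU1 T T g) fsetD1K // => /imE.
have stepC x y : e x y -> x \in C -> y \in C.
  move=> exy xC; have [D mD nD] := spanned y.
  apply: (@circuit_adj T e C D x y) => //; last exact: minC.
    exact: (@adj_sym G).
  exact: (@adj_irrefl G).
have allC (y : T) : y \in C.
  move: x0C; elim: {x0 y}(Gconn x0 y) => // x z w _ xz _ zw /xz; exact: zw.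
by apply: Ginf; apply: (@sub_finite_set T _ [set` C]) => // x _; apply: allC.
Qed.
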